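(* For every integer $r \geq 2$, $$\operatorname{ex}(n, K^{(r)}_{2,\dots,2}) = \Omega\left(n^{r - \frac{1}{r}}\right) \quad (n \to \infty),$$ i.e. for every integer $r \ge 2$ there exist a constant $c > 0$ and an integer $n_0$ (depending only on $r$) such that $\operatorname{ex}(n, K^{(r)}_{2,\dots,2}) \geq c\, n^{r - 1/r}$ for all $n \geq n_0$.
   Context: A hypergraph $H=(V,E)$ consists of a set $V$ of vertices and a set $E$ of edges, each edge being a subset of $V$; it is $r$-uniform if every edge has exactly $r$ vertices. The complete $r$-partite $r$-uniform hypergraph $K^{(r)}_{s_1,\dots,s_r}$ has as vertex set a disjoint union of $r$ parts of sizes $s_1,\dots,s_r$, and its edges are all $s_1\cdots s_r$ sets containing exactly one vertex from each part; $K^{(r)}_{2,\dots,2}$ is the case of $r$ parts of size $2$. For an $r$-uniform hypergraph $H$, the Turán number $\operatorname{ex}(n,H)$ is the maximum number of edges in an $r$-uniform hypergraph on $n$ vertices containing no copy of $H$ (as a not necessarily induced subhypergraph). *)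

(* Defs.v *)
From mathcomp Require Import all_boot.

Set Implicit Arguments.
Unset Strict Implicit.
Unset Printing Implicit Defensive.

Definition hypergraph (V : finType) := {set {set V}}.

Definition uniform (V : finType) (r : nat) (E : hypergraph V) : bool :=
  [forall e in E, #|e| == r].

(* Not necessarily induced: edges of F are sent to edges of E, and the image
   of f may span further edges of E. *)
Definition contains_copy (V W : finType) (E : hypergraph V)
    (F : hypergraph W) : bool :=
  [exists f : {ffun W -> V},
    injectiveb f && [forall e in F, f @: e \in E]].

(* The maximum is 0 when no r-uniform hypergraph on n vertices is F-free,
   which happens only if F has no edges. *)
Definition turan (r n : nat) (W : finType) (F : hypergraph W) : nat :=
  \max_(E : hypergraph 'I_n | uniform r E && ~~ contains_copy E F) #|E|.

(* Vertex x of the disjoint union of the 'I_(s i) lies in part number tag x. *)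
Definition complete_multipartite (r : nat) (s : 'I_r -> nat) :
    hypergraph {i : 'I_r & 'I_(s i)} :=
  [set e : {set {i : 'I_r & 'I_(s i)}} |
    [forall i, #|[set x in e | tag x == i]| == 1]].

(* Main.v *)
(** Let [L] be the degree [r] extension of the field with [q] elements and
    [lam : L -> F_q] a nonzero linear form.  Take [r] copies of [L] as parts,
    and as edges the tuples [x] with [lam (x_1 ... x_r) = 1]: there are about
    [N ^ r / q] of them, where [N = q ^ r], that is [N ^ (r - 1/r)].

    A copy of [K(2,...,2)] gives [y0 i != y1 i] such that [lam] equals [1] on
    all products of choices.  Put [b i := y1 i / y0 i - 1], which is nonzero,
    and [mu x := lam (x * \prod_i y0 i)].  Then [mu 1 = 1], whereas [mu]
    vanishes on the span [W_k] of the products of nonempty subfamilies of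
    [b_1, ..., b_k], so that [1] is not in [W_k].  But
    [W_(k+1) = W_k + b_(k+1) (1 + W_k)] has dimension at least
    [\dim (1 + W_k) > \dim W_k], so [W_r] is all of [L], a contradiction. *)

Require Import Defs.
From mathcomp Require Import all_boot all_order all_fingroup all_solvable.
From mathcomp Require Import all_algebra all_field.

Set Implicit Arguments.
Unset Strict Implicit.
Unset Printing Implicit Defensive.

Import GRing.Theory FinRing.Theory.
Local Open Scope ring_scope.

(** * Finite field extensions of prescribed degree *)

Lemma card_finField_natr (F : finFieldType) : #|F|%:R = 0 :> F.
Proof.
by apply/eqP; rewrite -zmodXgE -cardsT expg_cardG ?inE.
Qed.

(** [L] is the splitting field of [X^m - X] with [m = #|F| ^ r]. The roots are distinct and form a
    subfield, so they exhaust [L], which thus has [m] elements. *)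
Lemma exists_finField_ext (F : finFieldType) (r : nat) :
  (0 < r)%N -> exists L : fieldExtType F, \dim {:L} = r.
Proof.
move=> r_gt0; set m := (#|F| ^ r)%N.
have F_gt1 : (1 < #|F|)%N := finNzRing_gt1 F.
have m_gt1 : (1 < m)%N by rewrite (ltn_exp2l 0).
pose p : {poly F} := 'X^m - 'X.
have size_q (R : nzRingType) : size ('X^m - 'X : {poly R}) = m.+1.
  by rewrite size_polyDl size_polyXn // size_polyN size_polyX.
have p_neq0 : p != 0 by rewrite -size_poly_eq0 size_q.
have [L [zs]] := FinSplittingFieldFor p_neq0.
rewrite rmorphB rmorphXn /= map_polyX => Dp defL.
have m0 : m%:R = 0 :> L.
  rewrite -(rmorph_nat (in_alg L)) natrX card_finField_natr expr0n gtn_eqF //.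
  exact: rmorph0.
(* The derivative of [p] is [-1] because [m] vanishes in [L]. *)
have Uzs : uniq zs.
  rewrite -separable_prod_XsubC -(eqp_separable Dp) separable_poly.unlock.
  rewrite derivB derivXn derivX -mulr_natl -polyC_natr m0 polyC0 mul0r sub0r.
  by rewrite -[- 1]scaleN1r coprimepZr ?oppr_eq0 ?oner_eq0 // coprimep1.
(* [a] is the Frobenius map of [L] over [F], so the fixed points of its [r]-th power are exactly the
   roots of [p]. *)
have [/= a _ Da] := finField_galois_generator (sub1v {:L}).
rewrite dimv1 expn1 in Da.
pose E := fixedSpace (a ^+ r)%g.
have in_zs z : (z \in zs) = (z \in E).
  rewrite -root_prod_XsubC -(eqp_root Dp) (sameP fixedSpaceP eqP).
  rewrite /root !hornerE subr_eq0 /m; congr (_ == z).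
  elim: (r) => [|i IHi]; first by rewrite gal_id.
  by rewrite expgSr expnSr exprM IHi galM ?Da ?memvf.
have fixL : ({:L} <= E)%VS.
  rewrite -[X in (X <= _)%VS]defL -[E]subfield_closed agenvS //.
  by rewrite subv_add sub1v; apply/span_subvP=> z; rewrite in_zs.
exists L; apply/eqP; rewrite -(eqn_exp2l _ _ F_gt1) -/m.
rewrite -(@card_vspace F (finvect_type L) (Vector.class (finvect_type L)) {:L}).
have -> : #|({:L}%VS : {vspace finvect_type L})| = size zs.
  rewrite -(@card_uniqP (finvect_type L) zs Uzs); apply: eq_card => z.
  by rewrite in_zs (subvP fixL) memvf.
by rewrite -eqSS -(size_prod_XsubC _ id) -(eqp_size Dp) size_q.
Qed.

(** * Linear forms constant on a box of products *)

Section BoxSpan.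
Variables (F : fieldType) (L : fieldExtType F).

(* The space [W_k] of the introduction, for [b_i = t_i - 1], [t_i] in [s]. *)
Fixpoint box_span (s : seq L) : {vspace L} :=
  if s is t :: s'
  then (box_span s' + (1 + box_span s') * <[t - 1]>)%VS else 0%VS.

(** The masks starting with [false] and with [true] let the induction apply to [mu] and to
    [mu (t * _)]. As moreover [mu 1 = mu t = v], [mu] also kills [(t - 1) * (1 + W)], where [W] is
    the span of the tail. *)
Lemma box_span_vanish (mu : L -> F) (v : F) (s : seq L) :
  scalar mu ->
  (forall m : bitseq, size m = size s -> mu (\prod_(t <- mask m s) t) = v) ->
  {in box_span s, forall w, mu w = 0}.
Proof.
elim: s mu => [|t s IHs] mu mu_lin mu_mask w /=.
  rewrite memv0 => /eqP->.
  by have := mu_lin (-1) 0 0; rewrite scaler0 addr0 mulN1r addNr.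
have mu0 : {in box_span s, forall w, mu w = 0}.
  apply: IHs => // m sz_m.
  by rewrite -(mu_mask (false :: m)) //= sz_m.
have mut_lin : scalar (fun x => mu (t * x)).
  by move=> a x y; rewrite mulrDr -scalerAr mu_lin.
have mut0 : {in box_span s, forall w, mu (t * w) = 0}.
  apply: (IHs (fun x => mu (t * x))) => // m sz_m.
  by rewrite -(mu_mask (true :: m)) //= ?big_cons // sz_m.
have mu1 : mu 1 = v.
  rewrite -(mu_mask (nseq (size s).+1 false)) ?size_nseq //.
  by rewrite mask_false big_nil.
have mut1 : mu t = v.
  rewrite -(mu_mask (true :: nseq (size s) false)) /= ?size_nseq //.
  by rewrite mask_false big_seq1.
have muB x y : mu (x - y) = mu x - mu y.
  by rewrite addrC -scaleN1r mu_lin mulN1r addrC.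
have muD x y : mu (x + y) = mu x + mu y.
  by rewrite -{1}[x]scale1r mu_lin mul1r.
have muZ a x : mu (a *: x) = a * mu x.
  by rewrite -[a *: x]addr0 mu_lin -(subrr 0) muB subrr addr0.
case/memv_addP=> u u_s [_ /memv_cosetP[x x_s ->] ->].
have{x_s} [_ /vlineP[a ->] [z z_s ->]] := memv_addP x_s.
rewrite muD (mu0 u) // add0r mulrC mulrBl mul1r muB !mulrDr !muD.
by rewrite (mut0 z) // (mu0 z) // -scalerAr mulr1 !muZ mu1 mut1 !addr0 subrr.
Qed.

Lemma box_span_dim (s : seq L) :
  1 \notin s -> 1 \notin box_span s -> (size s <= \dim (box_span s))%N.
Proof.
elim: s => //= t s IHs; rewrite inE negb_or => /andP[t1 s1] W1.
have W1' : 1 \notin box_span s.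
  by apply: contra W1; apply/subvP/addvSl.
apply: leq_ltn_trans (IHs s1 W1') _.
apply: (@leq_trans (\dim (1 + box_span s))).
  rewrite ltn_neqAle dimvS ?addvSr // andbT.
  rewrite (dimv_leqif_sup (addvSr _ _)) subv_add subvv andbT.
  by rewrite -memvE.
(* Multiplication by the nonzero [t - 1] preserves dimension. *)
rewrite -(@dim_cosetv _ _ (1 + box_span s) (t - 1)) ?subr_eq0 1?eq_sym //.
by rewrite dimvS ?addvSr.
Qed.

Lemma no_constant_box (I : finType) (y0 y1 : I -> L) (lam : L -> F) (v : F) :
  (\dim {:L} <= #|I|)%N -> scalar lam -> v != 0 ->
  (forall e : {set I}, lam (\prod_i (if i \in e then y1 i else y0 i)) = v) ->
  exists i, y0 i = y1 i.
Proof.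
move=> dimL lam_lin v_neq0 lam_box.
have lam0 : lam 0 = 0.
  by have := lam_lin (-1) 0 0; rewrite scaler0 addr0 mulN1r addNr.
(* If [y0 i] were zero, the choice [e = set0] would give [v = lam 0 = 0]. *)
have y0_neq0 i : y0 i != 0.
  apply: contraNneq v_neq0 => y0i.
  rewrite -(lam_box set0) (bigD1 i) //= inE y0i mul0r.
  exact/eqP.
pose s := [seq y1 i / y0 i | i <- enum I].
have size_s : size s = #|I| by rewrite size_map -cardE.
case: (boolP (1 \in s)) => [/mapP[i _ /esym y1i]|s1].
  by exists i; rewrite -[LHS]mul1r -y1i divfK.
pose mu x := lam ((\prod_i y0 i) * x).
have mu_lin : scalar mu.
  by move=> a x y; rewrite /mu mulrDr -scalerAr lam_lin.
have mu_mask (m : bitseq) : size m = size s -> mu (\prod_(t <- mask m s) t) = v.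
  move=> _; rewrite -(lam_box [set i in mask m (enum I)]) /mu; congr lam.
  rewrite -map_mask big_map [X in _ * X]big_uniq ?mask_uniq ?enum_uniq //=.
  rewrite [X in _ * X]big_mkcond -big_split; apply: eq_bigr => i _ /=.
  by rewrite inE; case: ifP => _; rewrite ?mulr1 // mulrC divfK.
have mu0 := box_span_vanish mu_lin mu_mask.
have W1 : 1 \notin box_span s.
  apply: contraNN v_neq0 => /mu0 <-.
  by rewrite -(mu_mask (nseq (size s) false)) ?size_nseq // mask_false big_nil.
have := box_span_dim s1 W1; rewrite size_s => /(leq_trans dimL).
rewrite (geq_leqif (dimv_leqif_sup (subvf _))) => /subvP/(_ 1 (memvf _)).
by rewrite (negPf W1).
Qed.

End BoxSpan.

(* From box-free sets of tuples to Turán numbers *)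
Local Close Scope ring_scope.

(** The host has [r] copies of [K] as parts and the graphs of the tuples in [S] as edges. A copy of
    the forbidden hypergraph may permute the parts, so its parts must be matched with those of the
    host before the hypothesis on [S] applies. *)
Lemma turan_ge_box_free (r n : nat) (K : finType) (S : {set {ffun 'I_r -> K}}) :
  r * #|K| <= n ->
  (forall y : 'I_r -> 'I_2 -> K,
    (forall e : 'I_r -> 'I_2, [ffun i => y i (e i)] \in S) ->
    exists i, y i ord0 = y i ord_max) ->
  #|S| <= turan r n (complete_multipartite (fun _ : 'I_r => 2)).
Proof.
move=> rKn S_free.
have le_n : #|{: 'I_r * K}| <= n by rewrite card_prod card_ord.
pose g (u : 'I_r * K) := widen_ord le_n (enum_rank u).
have g_inj : injective g by move=> u v [] /val_inj/enum_rank_inj.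
pose edge (x : {ffun 'I_r -> K}) := [set g (i, x i) | i : 'I_r].
have mem_edge x j a : g (j, a) \in edge x -> x j = a.
  by case/imsetP=> i _ /g_inj [-> ->].
have edge_inj : injective edge.
  move=> x x' eq_e; apply/ffunP=> i; apply/esym/mem_edge.
  by rewrite -eq_e; apply: imset_f.
rewrite -(card_imset _ edge_inj); apply: leq_bigmax_cond; apply/andP; split.
  apply/forall_inP=> _ /imsetP[x _ ->].
  by rewrite card_imset ?card_ord // => i j /g_inj[].
apply/existsP=> -[f /andP[/injectiveP f_inj /forall_inP f_copy]].
pose vtx i b := @Tagged _ i (fun _ : 'I_r => 'I_2) b : {i : 'I_r & 'I_2}.
have vtx_inj i j b c : vtx i b = vtx j c -> i = j /\ b = c.
  move=> eq_v; have eq_ij : i = j by have := congr1 (@tag _ _) eq_v.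
  by subst j; split=> //; move/eqP: eq_v; rewrite eq_Tagged => /eqP.
have copy_edge (e : 'I_r -> 'I_2) :
    exists2 x, x \in S & [set f (vtx i (e i)) | i : 'I_r] = edge x.
  have /f_copy : [set vtx i (e i) | i : 'I_r]
      \in complete_multipartite (fun _ : 'I_r => 2).
    rewrite inE; apply/forallP=> i; apply/cards1P; exists (vtx i (e i)).
    apply/setP=> v; rewrite !inE; apply/andP/eqP=> [[/imsetP[j _ ->]]|->].
      by rewrite /= => /eqP->.
    by split=> //; apply/imsetP; exists i.
  by case/imsetP=> x Sx; rewrite -imset_comp; exists x.
(* Each vertex of the copy lies on an edge, so it avoids the leftover vertices of ['I_n]. *)
have ex_F i b : exists u, f (vtx i b) == g u.
  have [x _ eq_x] := copy_edge (fun=> b).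
  have : f (vtx i b) \in edge x by rewrite -eq_x; apply: imset_f.
  by case/imsetP=> j _ ->; exists (j, x j).
pose F i b := xchoose (ex_F i b).
have fF i b : f (vtx i b) = g (F i b) by apply/eqP/(xchooseP (ex_F i b)).
have F_inj i j b c : F i b = F j c -> i = j /\ b = c.
  by move/(congr1 g); rewrite -!fF => /f_inj/vtx_inj.
have transversal (e : 'I_r -> 'I_2) : exists2 x, x \in S &
    (forall i, F i (e i) = ((F i (e i)).1, x (F i (e i)).1)) /\
    (forall j, exists i, (F i (e i)).1 = j).
  have [x Sx eq_x] := copy_edge e; exists x => //; split=> [i|j].
    have : f (vtx i (e i)) \in edge x by rewrite -eq_x; apply: imset_f.
    by rewrite fF; case: (F i _) => j a /= /mem_edge ->.
  have : g (j, x j) \in edge x by apply: imset_f.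
  rewrite -eq_x => /imsetP[i _]; rewrite fF => /g_inj eqF; exists i.
  by rewrite -eqF.
(* Both vertices of a part of the copy lie in the same part of the host:
   exchanging one for the other in a transversal must give a transversal. *)
have same_part i b : (F i b).1 = (F i ord0).1.
  have [x _ [_ /(_ (F i b).1)[k Fk]]] := transversal (fun=> ord0).
  have [eq_ik|ki] := eqVneq i k; first by rewrite -Fk eq_ik.
  have [x' _ [Fx' _]] := transversal (fun j => if j == i then b else ord0).
  have := Fx' i; have := Fx' k; rewrite eqxx eq_sym (negPf ki) Fk => <-.
  by case/F_inj => /eqP; rewrite (negPf ki).
have ex_tau j : exists i, (F i ord0).1 == j.
  have [x _ [_ /(_ j)[i <-]]] := transversal (fun=> ord0).
  by exists i.
(* [tau j] is the part of the copy sent into part [j] of the host. *)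
pose tau j := xchoose (ex_tau j).
have tauP j b : (F (tau j) b).1 = j.
  by rewrite same_part; apply/eqP/(xchooseP (ex_tau j)).
have [|j eq_j] := S_free (fun j b => (F (tau j) b).2).
  move=> e; have [x Sx [Fx _]] := transversal (fun i => e (F i ord0).1).
  suff -> : [ffun j => (F (tau j) (e j)).2] = x by [].
  by apply/ffunP=> j; rewrite ffunE; have := Fx (tau j); rewrite !tauP => ->.
have /F_inj[_ /eqP//] : F (tau j) ord0 = F (tau j) ord_max.
by apply/eqP; rewrite -pair_eqE /pair_eq !tauP eq_j !eqxx.
Qed.

Local Open Scope ring_scope.

(** * Counting tuples whose product lies in a fibre of a linear form *)

Section ProductFibre.
Variables (F : finFieldType) (L : fieldExtType F).
Local Notation K := (finvect_type L).

(** The translates of the fibre by multiples of [e] cover [K]. *)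
Lemma card_scalar_fibre (lam : K -> F) :
  scalar lam -> (exists e, lam e = 1) ->
  (#|K| <= #|F| * #|[set z : K | lam z == 1%R]|)%N.
Proof.
move=> lam_lin [e lam_e]; rewrite -cardsT -[#|F|]cardsT -cardsX.
set A := setX _ _.
apply: leq_trans (leq_imset_card (fun u : F * K => u.1 *: e + u.2) (mem A)).
apply/subset_leq_card/subsetP=> x _; apply/imsetP.
exists (lam x - 1, - (lam x - 1) *: e + x); last first.
  by rewrite /= scaleNr addNKr.
by rewrite !inE lam_lin lam_e mulr1 opprB subrK eqxx.
Qed.

(** Choose the last [r] coordinates freely among nonzero elements and the product [z] in the fibre;
    the coordinate at [ord0] is then forced. *)
Lemma card_prod_fibre (lam : K -> F) (r : nat) :
  (#|K|.-1 ^ r * #|[set z : K | lam z == 1%R]|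
     <= #|[set x : {ffun 'I_r.+1 -> K} | lam (\prod_i x i)%R == 1%R]|)%N.
Proof.
set Z := [set z | _].
pose Y := [set y : {ffun 'I_r -> K} | y \in ffun_on (predC1 (0 : K))].
have -> : (#|K|.-1 ^ r)%N = #|Y|.
  by rewrite cardsE card_ffun_on card_ord cardC1.
rewrite -cardsX.
pose phi (u : {ffun 'I_r -> K} * K) : {ffun 'I_r.+1 -> K} :=
  [ffun i => if unlift ord0 i is Some j then u.1 j else u.2 / \prod_j u.1 j].
have phi0 u : phi u ord0 = u.2 / \prod_j u.1 j by rewrite ffunE unlift_none.
have phiS u j : phi u (lift ord0 j) = u.1 j by rewrite ffunE liftK.
have prod_neq0 u : u \in setX Y Z -> \prod_j u.1 j != 0.
  rewrite !inE => /andP[/ffun_onP u_neq0 _].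
  by apply/prodf_neq0=> j _; have := u_neq0 j; rewrite inE.
have phi_inj : {in setX Y Z &, injective phi}.
  move=> [y z] [y' z'] /prod_neq0/= y_neq0 _ eq_phi.
  have eq_y : y = y' by apply/ffunP=> j; rewrite -(phiS (y, z)) eq_phi phiS.
  have := congr1 (fun x : {ffun _} => x ord0) eq_phi.
  by rewrite !phi0 /= -eq_y => /divIf->.
rewrite -(card_in_imset phi_inj).
apply/subset_leq_card/subsetP=> _ /imsetP[u Au ->].
rewrite inE big_ord_recl phi0.
rewrite [X in _ * X](eq_bigr (fun j => u.1 j)) => [|j _]; last exact: phiS.
by rewrite divfK ?prod_neq0 //; move: Au; rewrite !inE => /andP[].
Qed.

End ProductFibre.

Lemma turan_ge_finField (F : finFieldType) (r n : nat) :
  (r.+1 * #|F| ^ r.+1 <= n)%N ->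
  ((#|F| ^ r.+1).-1 ^ r * #|F| ^ r
    <= turan r.+1 n (complete_multipartite (fun _ : 'I_r.+1 => 2)))%N.
Proof.
move=> le_n; have F_gt0 : (0 < #|F|)%N := ltnW (finNzRing_gt1 F).
have [L dimL] := exists_finField_ext F (ltn0Sn r).
pose K := finvect_type L.
have cardK : #|K| = (#|F| ^ r.+1)%N.
  by rewrite -dimL -(@card_vspacef F K (Vector.class K)) card_vspace.
have free_basis := basis_free (vbasisP {:L}).
have i0 : 'I_(\dim {:L}) by rewrite dimL; exact: ord0.
pose lam : K -> F := coord (vbasis {:L}) i0.
have lam_lin : scalar lam by move=> a x y; rewrite /lam linearP.
have lam_e : exists e, lam e = 1.
  by exists (vbasis {:L})`_i0; rewrite /lam coord_free // eqxx.
rewrite -cardK in le_n *.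
apply: leq_trans (turan_ge_box_free
  (S := [set x : {ffun 'I_r.+1 -> K} | lam (\prod_i x i) == 1]) le_n _).
  apply: leq_trans (card_prod_fibre lam r); rewrite leq_mul2l; apply/orP; right.
  by rewrite -(leq_pmul2l F_gt0) -expnS -cardK card_scalar_fibre.
move=> y lam_y.
apply: (@no_constant_box F L _ (y^~ ord0) (y^~ ord_max) lam 1) => //.
- by rewrite dimL card_ord.
- exact: oner_neq0.
move=> e; have := lam_y (fun i => if i \in e then ord_max else ord0).
rewrite inE => /eqP <-; congr lam; apply: eq_bigr => i _.
by rewrite ffunE; case: ifP.
Qed.

(* Passage to arbitrary [n] *)
Local Close Scope ring_scope.

(** Take [q] to be the largest power of 2 for which the construction fits in [n] vertices; rounding
    down costs only a factor below [2 ^ r.+1] in the number of vertices. *)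
Lemma turan_ge_power (r n : nat) :
  r.+1 * 2 ^ r.+1 <= n ->
  exists2 q : nat, n <= r.+1 * 2 ^ r.+1 * q ^ r.+1 &
    q ^ (r * r.+2)
      <= 2 ^ r * turan r.+1 n (complete_multipartite (fun _ : 'I_r.+1 => 2)).
Proof.
move=> n_large; pose M := 2 ^ r.+1.
have M_gt1 : 1 < M by rewrite (ltn_exp2l 0).
have le_M : M <= n %/ r.+1 by rewrite leq_divRL // mulnC.
pose k := trunc_log M (n %/ r.+1).
have k_gt0 : 0 < k by apply: trunc_log_max; rewrite ?expn1.
have /andP[Mk_le lt_Mk] : M ^ k <= n %/ r.+1 < M ^ k.+1.
  by apply: trunc_log_bounds => //; apply: leq_trans le_M; apply: ltnW.
have Mk : M ^ k = (2 ^ k) ^ r.+1 by rewrite -!expnM mulnC.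
exists (2 ^ k).
  rewrite -Mk -mulnA -expnS mulnC; apply: ltnW.
  by rewrite -ltn_divLR.
have [F _ cardF] := pPrimePowerField (isT : prime 2) k_gt0.
have := @turan_ge_finField F r n; rewrite cardF -Mk mulnC -leq_divRL //.
move=> /(_ Mk_le) le_turan.
apply: leq_trans (leq_mul (leqnn (2 ^ r)) le_turan).
(* Since [r * r.+2 = r.+1 * r + r], it remains to bound [M ^ k] by twice its predecessor; this is
   where the factor [2 ^ r] is spent. *)
rewrite mulnA -expnMn mulnS addnC expnD (mulnC r) expnM -Mk.
rewrite leq_mul2r; apply/orP; right.
have [->|r_gt0] := posnP r; first by [].
rewrite leq_exp2r // mul2n -addnn -[leqLHS]prednK ?expn_gt0 ?(ltnW M_gt1) //.
rewrite -addn1 leq_add2l -ltnS prednK ?expn_gt0 ?(ltnW M_gt1) //.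
by rewrite -{1}(expn0 M) ltn_exp2l.
Qed.

From mathcomp Require Import all_classical all_reals all_analysis.
Import Order.TTheory Num.Theory.
Local Open Scope ring_scope.

Theorem theorem3p2 (R : realType) (r : nat) (hr : (2 <= r)%N) :
  exists2 c : R, 0 < c &
  exists n0 : nat, forall n : nat, (n0 <= n)%N ->
    c * n%:R `^ (r%:R - r%:R^-1)
      <= (turan r n (complete_multipartite (fun _ : 'I_r => 2%N)))%:R.
Proof.
case: r hr => // s _; pose C := (s.+1 * 2 ^ s.+1)%N.
pose a : R := s.+1%:R - s.+1%:R^-1.
have C_gt0 : 0 < C%:R :> R by rewrite ltr0n muln_gt0 expn_gt0.
have a_ge0 : 0 <= a.
  by rewrite subr_ge0 (@le_trans _ _ 1) ?invf_le1 ?ler1n ?ltr0n.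
have s_neq0 : s.+1%:R != 0 :> R by rewrite pnatr_eq0.
(* This is [r * (r - 1/r) = r ^ 2 - 1] for [r = s.+1]: the exponent of [q] in [turan_ge_power]. *)
have aE : s.+1%:R * a = (s * s.+2)%:R.
  apply/eqP; rewrite mulrBr divff // -natrM subr_eq natr1.
  by rewrite mulSn addSn -mulnS.
(* From [n <= C * q ^ s.+1] follows [n ^ a <= C ^ a * q ^ (s * s.+2)], and the last power is at most
   [2 ^ s] times the Turán number. *)
exists (C%:R `^ a * 2 ^+ s)^-1.
  by rewrite invr_gt0 mulr_gt0 ?powR_gt0 ?exprn_gt0.
exists C => n /turan_ge_power[q le_n le_q].
rewrite mulrC ler_pdivrMr ?mulr_gt0 ?powR_gt0 ?exprn_gt0 //.
apply: (@le_trans _ _ ((C * q ^ s.+1)%:R `^ a)).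
  by apply: ge0_ler_powR; rewrite ?nnegrE ?ler0n // ler_nat.
rewrite natrM powRM ?ler0n // natrX -powR_mulrn ?ler0n //.
rewrite -powRrM aE powR_mulrn //.
rewrite mulrCA ler_pM2l ?powR_gt0 // mulrC -!natrX -natrM ler_nat.
exact: le_q.
Qed.
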